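(* There exist natural numbers $l,m,n$ such that the following set is undecidable: the set of prenex sentences in the first-order language with binary relation symbol $\sim$ and equality whose quantifier prefix has the form $\exists^j\forall^l\exists^m\forall^n$ for some $j\ge0$ (i.e. $j$ existential quantifiers, then $l$ universal, then $m$ existential, then $n$ universal) and which are true on some finite graph.
   Context: A graph is a structure for this language in which $\sim$ is interpreted by an irreflexive symmetric relation. *)

(* Defs.v *)
From mathcomp Require Import all_boot.
Set Implicit Arguments. Unset Strict Implicit. Unset Printing Implicit Defensive.

Inductive form : Type :=
  | FRel of nat & nat
  | FEq  of nat & nat
  | FBot
  | FNeg of form
  | FAnd of form & form
  | FOr  of form & form
  | FImp of form & form
  | FEx  of nat & form
  | FAll of nat & form.

Fixpoint fv (f : form) : seq nat :=
  match f with
  | FRel x y | FEq x y => [:: x; y]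
  | FBot => [::]
  | FNeg g => fv g
  | FAnd g h | FOr g h | FImp g h => fv g ++ fv h
  | FEx x g | FAll x g => [seq z <- fv g | z != x]
  end.

Definition sentence (f : form) : bool := nilp (fv f).

Fixpoint qfree (f : form) : bool :=
  match f with
  | FRel _ _ | FEq _ _ | FBot => true
  | FNeg g => qfree g
  | FAnd g h | FOr g h | FImp g h => qfree g && qfree h
  | FEx _ _ | FAll _ _ => false
  end.

Fixpoint has_prefix (p : seq bool) (f : form) : bool :=
  match p, f with
  | [::], _ => qfree f
  | true :: p', FEx _ g => has_prefix p' g
  | false :: p', FAll _ g => has_prefix p' g
  | _, _ => false
  end.

Definition prefix_EAEA (j l m n : nat) : seq bool :=
  nseq j true ++ nseq l false ++ nseq m true ++ nseq n false.

Definition in_class (l m n : nat) (f : form) : Prop :=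
  sentence f /\ exists j, has_prefix (prefix_EAEA j l m n) f.

Definition upd (T : Type) (rho : nat -> T) (x : nat) (a : T) : nat -> T :=
  fun z => if z == x then a else rho z.

Fixpoint sat (T : Type) (e : T -> T -> bool) (rho : nat -> T) (f : form) : Prop :=
  match f with
  | FRel x y => e (rho x) (rho y)
  | FEq x y => rho x = rho y
  | FBot => False
  | FNeg g => ~ sat e rho g
  | FAnd g h => sat e rho g /\ sat e rho h
  | FOr g h => sat e rho g \/ sat e rho h
  | FImp g h => sat e rho g -> sat e rho h
  | FEx x g => exists a : T, sat e (upd rho x a) g
  | FAll x g => forall a : T, sat e (upd rho x a) g
  end.

Definition true_on_some_finite_graph (f : form) : Prop :=
  exists (T : finType) (t0 : T) (e : rel T),
    irreflexive e /\ symmetric e /\ forall rho : nat -> T, sat e rho f.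

Definition cpair (a b : nat) : nat := ((a + b) * (a + b).+1) %/ 2 + b.

Fixpoint encode (f : form) : nat :=
  match f with
  | FRel x y => cpair 0 (cpair x y)
  | FEq x y => cpair 1 (cpair x y)
  | FBot => cpair 2 0
  | FNeg g => cpair 3 (encode g)
  | FAnd g h => cpair 4 (cpair (encode g) (encode h))
  | FOr g h => cpair 5 (cpair (encode g) (encode h))
  | FImp g h => cpair 6 (cpair (encode g) (encode h))
  | FEx x g => cpair 7 (cpair x (encode g))
  | FAll x g => cpair 8 (cpair x (encode g))
  end.

Inductive recfun : Type :=
  | RZero
  | RSucc
  | RProj of nat
  | RComp of recfun & seq recfun
  | RPrim of recfun & recfun
  | RMu of recfun.

Inductive reval : recfun -> seq nat -> nat -> Prop :=
  | ev_zero xs : reval RZero xs 0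
  | ev_succ x xs : reval RSucc (x :: xs) x.+1
  | ev_proj i xs : i < size xs -> reval (RProj i) xs (nth 0 xs i)
  | ev_comp f gs xs ys y :
      reval_list gs xs ys -> reval f ys y -> reval (RComp f gs) xs y
  | ev_prim0 f g xs y : reval f xs y -> reval (RPrim f g) (0 :: xs) y
  | ev_primS f g n xs r y :
      reval (RPrim f g) (n :: xs) r -> reval g (n :: r :: xs) y ->
      reval (RPrim f g) (n.+1 :: xs) y
  | ev_mu f xs y :
      reval f (y :: xs) 0 ->
      (forall z, z < y -> exists k, reval f (z :: xs) k.+1) ->
      reval (RMu f) xs y
with reval_list : seq recfun -> seq nat -> seq nat -> Prop :=
  | evl_nil xs : reval_list [::] xs [::]
  | evl_cons g gs xs y ys :
      reval g xs y -> reval_list gs xs ys -> reval_list (g :: gs) xs (y :: ys).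

Definition decidable_set (P : form -> Prop) : Prop :=
  exists r : recfun, forall f : form,
    (P f -> reval r [:: encode f] 1) /\ (~ P f -> reval r [:: encode f] 0).

(* Main.v *)
Require Import Defs.
From mathcomp Require Import all_boot zify.
Set Implicit Arguments. Unset Strict Implicit. Unset Printing Implicit Defensive.

(* Let [r] decide the set.  To a recursive function [h] and an input [n] one
   attaches a sentence of prefix exists^j forall^10 exists^40 which, if [h]
   returns 0 on [n], is true on some finite graph and, if [h] returns a nonzero
   value on [n], is true on no graph at all.  The sentence speaks of a ternary
   relation H(x, k, y), "the operation k maps x to y", which a graph encodes by
   three gadget vertices per triple.  Each subprogram of [h] is named by one of
   the leading existential variables, so its evaluation rule "H(x, k, y) implies
   the existence of the values it was computed from" is guarded by "k is this
   constant", and any number of rules fits into one forall-exists block.  The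
   input is named by a chain of constants, so the sentence is computable from [n]
   and the code of the [h]-dependent part [B] of its matrix.  Feeding that code as
   the input, with [h] := [r] composed with this computation, gives a sentence
   that is true on a finite graph if and only if [r] rejects it. *)

(** * Recursive functions *)

Section RevalInd.
Variables (P : recfun -> seq nat -> nat -> Prop).
Variables (Q : seq recfun -> seq nat -> seq nat -> Prop).
Hypothesis Pzero : forall xs, P RZero xs 0.
Hypothesis Psucc : forall x xs, P RSucc (x :: xs) x.+1.
Hypothesis Pproj : forall i xs, i < size xs -> P (RProj i) xs (nth 0 xs i).
Hypothesis Pcomp : forall f gs xs ys y,
  Q gs xs ys -> P f ys y -> P (RComp f gs) xs y.
Hypothesis Pprim0 : forall f g xs y, P f xs y -> P (RPrim f g) (0 :: xs) y.
Hypothesis PprimS : forall f g n xs r y,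
  P (RPrim f g) (n :: xs) r -> P g (n :: r :: xs) y ->
  P (RPrim f g) (n.+1 :: xs) y.
Hypothesis Pmu : forall f xs y, P f (y :: xs) 0 ->
  (forall z, z < y -> exists k, P f (z :: xs) k.+1) -> P (RMu f) xs y.
Hypothesis Qnil : forall xs, Q [::] xs [::].
Hypothesis Qcons : forall g gs xs y ys,
  P g xs y -> Q gs xs ys -> Q (g :: gs) xs (y :: ys).

(** Written by hand so that the evaluations under [forall] and [exists] in [ev_mu] also carry an
    induction hypothesis. *)
Fixpoint reval_mind f xs y (d : reval f xs y) {struct d} : P f xs y :=
  match d in reval f xs y return P f xs y with
  | ev_zero xs => Pzero xs
  | ev_succ x xs => Psucc x xs
  | ev_proj i xs lt => Pproj lt
  | ev_comp f gs xs ys y dl df => Pcomp (reval_list_mind dl) (reval_mind df)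
  | ev_prim0 f g xs y df => Pprim0 g (reval_mind df)
  | ev_primS f g n xs r y dr dg => PprimS (reval_mind dr) (reval_mind dg)
  | ev_mu f xs y df dlt =>
    Pmu (reval_mind df)
        (fun z lt => match dlt z lt with
                     | ex_intro k dk => ex_intro _ k (reval_mind dk) end)
  end
with reval_list_mind gs xs ys (d : reval_list gs xs ys) {struct d} : Q gs xs ys :=
  match d in reval_list gs xs ys return Q gs xs ys with
  | evl_nil xs => Qnil xs
  | evl_cons g gs xs y ys dg dl => Qcons (reval_mind dg) (reval_list_mind dl)
  end.

End RevalInd.

Section RecfunInd.
Variable P : recfun -> Prop.
Hypothesis Pzero : P RZero.
Hypothesis Psucc : P RSucc.
Hypothesis Pproj : forall i, P (RProj i).
Hypothesis Pcomp : forall f gs, P f -> foldr (fun g => and (P g)) True gs -> P (RComp f gs).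
Hypothesis Pprim : forall f g, P f -> P g -> P (RPrim f g).
Hypothesis Pmu : forall f, P f -> P (RMu f).

Fixpoint recfun_nested_ind f : P f :=
  match f with
  | RZero => Pzero
  | RSucc => Psucc
  | RProj i => Pproj i
  | RComp f gs => Pcomp (recfun_nested_ind f)
      ((fix all_ind gs : foldr (fun g => and (P g)) True gs :=
        match gs with
        | [::] => I
        | g :: gs => conj (recfun_nested_ind g) (all_ind gs)
        end) gs)
  | RPrim f g => Pprim (recfun_nested_ind f) (recfun_nested_ind g)
  | RMu f => Pmu (recfun_nested_ind f)
  end.
End RecfunInd.

(** A Gödel numbering of programs, so that distinct subprograms get distinct constants. *)
Fixpoint rcode (p : recfun) : nat :=
  CodeSeq.code
    match p with
    | RZero => [:: 0]
    | RSucc => [:: 1]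
    | RProj i => [:: 2; i]
    | RComp f gs => [:: 3, rcode f & map rcode gs]
    | RPrim f g => [:: 4; rcode f; rcode g]
    | RMu f => [:: 5; rcode f]
    end.

Lemma rcode_inj : injective rcode.
Proof.
have cinj : injective CodeSeq.code := can_inj CodeSeq.codeK.
elim/recfun_nested_ind=> [||i|f gs IHf IHgs|f g IHf IHg|f IHf];
  case=> [||i'|f' gs'|f' g'|f'] /cinj // [].
- by move=> ->.
- move=> /IHf -> E; congr RComp.
  elim: gs IHgs gs' E => [|g gs IH] /= IHgs [|g' gs'] //= [].
  by case: IHgs => Hg /IH{}IH /Hg -> /IH ->.
- by move=> /IHf -> /IHg ->.
- by move=> /IHf ->.
Qed.

(** * Closure properties of computable functions *)

Definition computable (k : nat) (F : seq nat -> nat) : Prop :=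
  exists r, forall xs, size xs = k -> reval r xs (F xs).

Lemma eq_computable k F G :
  (forall xs, size xs = k -> F xs = G xs) -> computable k F -> computable k G.
Proof. by move=> E [r Hr]; exists r => xs sz; rewrite -E //; apply: Hr. Qed.

Lemma computable_proj k i : i < k -> computable k (nth 0 ^~ i).
Proof. by move=> lt; exists (RProj i) => xs sz; apply: ev_proj; rewrite sz. Qed.

Lemma computable_comp k (Gs : seq (seq nat -> nat)) F :
  computable (size Gs) F -> foldr (fun G => and (computable k G)) True Gs ->
  computable k (fun xs => F [seq G xs | G <- Gs]).
Proof.
move=> [r Hr] HGs.
have [rs Hrs]: exists rs, forall xs, size xs = k ->
    reval_list rs xs [seq G xs | G <- Gs].
  elim: Gs HGs {r F Hr} => [|G Gs IH] /=; first by exists [::] => *; constructor.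
  move=> [[g Hg] /IH [rs Hrs]]; exists (g :: rs) => xs sz.
  by constructor; [apply: Hg | apply: Hrs].
exists (RComp r rs) => xs sz; apply: ev_comp (Hrs _ sz) (Hr _ _).
by rewrite size_map.
Qed.

Lemma computable_succ k F : computable k F -> computable k (fun xs => (F xs).+1).
Proof.
move=> HF; pose S xs := (head 0 xs).+1.
have HS : computable 1 S by exists RSucc => -[|x [|]] // _; constructor.
exact: (@computable_comp k [:: F] S HS).
Qed.

Lemma computable_const k c : computable k (fun=> c).
Proof.
elim: c => [|c IH]; last exact: computable_succ.
by exists RZero => xs _; constructor.
Qed.

Lemma computable_prim k F G :
  computable k F -> computable k.+2 G ->
  computable k.+1 (fun xs =>
    nat_rect (fun=> nat) (F (behead xs)) (fun j r => G [:: j, r & behead xs]) (head 0 xs)).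
Proof.
move=> [rf Hf] [rg Hg]; exists (RPrim rf rg) => -[|n xs] //= [sz].
elim: n => [|n IH] /=; first by constructor; apply: Hf.
by apply: ev_primS IH _; apply: Hg; rewrite /= sz.
Qed.

Lemma computable_add k F G :
  computable k F -> computable k G -> computable k (fun xs => F xs + G xs).
Proof.
move=> HF HG; pose A xs := nth 0 xs 0 + nth 0 xs 1.
have HA : computable 2 A.
  apply: eq_computable (computable_prim (computable_proj (ltn0Sn 0))
                          (computable_succ (computable_proj (isT : 1 < 3)))).
  by case=> [|x [|y [|]]] //= _; rewrite /A /=; elim: x => //= x ->.
exact: (@computable_comp k [:: F; G] A HA).
Qed.

(** This recurrence of the triangular numbers makes [cpair] primitive recursive by additions
    alone. *)
Lemma tri_succ n : n.+1 * n.+2 %/ 2 = n * n.+1 %/ 2 + n.+1.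
Proof.
have -> : n.+1 * n.+2 = n.+1 * 2 + n * n.+1 by lia.
by rewrite divnMDl // addnC.
Qed.

Lemma computable_cpair k F G :
  computable k F -> computable k G -> computable k (fun xs => cpair (F xs) (G xs)).
Proof.
move=> HF HG; pose T xs := head 0 xs * (head 0 xs).+1 %/ 2.
have HT : computable 1 T.
  have H1 : computable 2 (fun xs => nth 0 xs 1 + (nth 0 xs 0).+1).
    by apply: computable_add; last apply: computable_succ; apply: computable_proj.
  apply: eq_computable (computable_prim (computable_const 0 0) H1).
  by case=> [|x [|]] //= _; rewrite /T /=; elim: x => //= x ->; rewrite tri_succ.
apply: computable_add => //.
apply: (@computable_comp k [:: fun xs => F xs + G xs] T HT); split=> //.
exact: computable_add.
Qed.

Lemma computable_iter k J F G :
  computable k J -> computable k F -> computable k.+2 G ->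
  computable k (fun xs =>
    nat_rect (fun=> nat) (F xs) (fun j r => G [:: j, r & xs]) (J xs)).
Proof.
move=> HJ HF HG; pose Ps := [seq nth 0 ^~ i | i <- iota 0 k].
have HP := computable_prim HF HG.
have szP : size (J :: Ps) = k.+1 by rewrite /= size_map size_iota.
rewrite -szP in HP; have := computable_comp (k := k) HP.
move=> H; apply: eq_computable (H _); last first.
  split=> //; rewrite /Ps; have: all (ltn^~ k) (iota 0 k).
    by apply/allP => i; rewrite mem_iota.
  by elim: (iota 0 k) => //= i s IH /andP[lt /IH]; split=> //; apply: computable_proj.
move=> xs sz /=; suff -> : [seq G0 xs | G0 <- Ps] = xs by [].
by rewrite -map_comp -sz -[RHS](mkseq_nth 0).
Qed.

(** * The sentences *)

Arguments cpair : simpl never.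

(** Mostly the operations [k] of facts H(x, k, y). [KArgs ps] runs several programs on one list and
    collects the results, [KLoop p] searches for a zero of [p] upward from the head of its list,
    [KNum i] yields i on any operand, and [KGoal] runs the main program. [KNil] names the empty
    list; [KTop] only triggers [topF]. *)
Inductive key : Type :=
  | KHd | KTl | KNil | KTop | KGoal
  | KNum of nat
  | KFun of recfun
  | KArgs of seq recfun
  | KLoop of recfun.

Definition key_code (k : key) : seq nat :=
  match k with
  | KHd => [:: 0] | KTl => [:: 1] | KNil => [:: 2] | KTop => [:: 3] | KGoal => [:: 4]
  | KNum _ => [::]
  | KFun p => [:: 5; rcode p]
  | KArgs ps => 6 :: map rcode ps
  | KLoop p => [:: 7; rcode p]
  end.

(* [locked] keeps unification from evaluating these huge unary numbers. *)
Definition kv (k : key) : nat :=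
  54 + locked (if k is KNum i then i.*2 else (CodeSeq.code (key_code k)).*2.+1).
Arguments kv : simpl never.

(** Parity separates the numerals from the other keys, and a leading tag separates those from each
    other. *)
Lemma kv_inj : injective kv.
Proof.
have ninj i j : i.*2 <> j.*2.+1 by lia.
have sinj s t : (CodeSeq.code s).*2.+1 = (CodeSeq.code t).*2.+1 -> s = t.
  by move=> E; apply: (can_inj CodeSeq.codeK); lia.
move=> k k' /addnI; rewrite -!lock; case: k => [|||||i|p|ps|p]; case: k' => [|||||i'|p'|ps'|p'];
  try by move=> /ninj.
all: try by move=> /esym /ninj.
all: try by move=> /sinj.
- by move=> E; congr KNum; lia.
- by move=> /sinj [] /rcode_inj ->.
- by move=> /sinj [] /(inj_map rcode_inj) ->.
- by move=> /sinj [] /rcode_inj ->.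
Qed.

Lemma kv_ge k : 54 <= kv k. Proof. exact: leq_addr. Qed.

(* Layout of the variables.
   0, 1, 2: a fact H(0, 1, 2); 3: a second value; 4-6 and 7-9: gadgets for these
   two facts.  10-16: witnesses of a rule; 17-49: gadgets for its atoms.
   50-52: markers of the three gadget kinds; 53: marker of the elements.
   From 54 on: the constants, even offsets being kept for [KNum] so that
   [kv (KNum n)] is computed by addition only. *)
Inductive atom : Type :=
  | AH of nat & nat & nat
  | AE of nat & nat.

(** The markers tell which coordinate each gadget vertex carries; the path [g], [g.+1], [g.+2] ties
    the coordinates of one triple together. *)
Definition edges (x k y g : nat) : seq (nat * nat) :=
  [:: (x, 53); (k, 53); (y, 53); (g, 50); (g.+1, 51); (g.+2, 52);
      (g, x); (g.+1, k); (g.+2, y); (g, g.+1); (g.+1, g.+2)].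

Definition factF (x k y g : nat) : form :=
  foldr (fun p => FAnd (FRel p.1 p.2)) (FNeg FBot) (edges x k y g).

Definition atomF (g : nat) (a : atom) : form :=
  match a with AH x k y => factF x k y g | AE x y => FEq x y end.

Fixpoint conjF (g : nat) (s : seq atom) : form :=
  if s is a :: s' then FAnd (atomF g a) (conjF (3 + g) s') else FNeg FBot.

(** The disjuncts share the gadget variables from 17 on, since one of them suffices; the longest has
    11 atoms and uses all 33. *)
Definition disjF (d : seq (seq atom)) : form := foldr FOr FBot (map (conjF 17) d).

Definition ruleF (k : key) (d : seq (seq atom)) : form :=
  FImp (FAnd (FEq 1 (kv k)) (factF 0 1 2 4)) (disjF d).

(** Variable 10 is to be the number [n] and 11 the list with sole entry [n]; the last atom claims
    that the main program returns 0 on it. *)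
Definition top_atoms (n : nat) : seq atom :=
  [:: AH (kv KNil) (kv (KNum n)) 10; AH 11 (kv KHd) 10; AH 11 (kv KTl) (kv KNil);
      AH 11 (kv KGoal) (kv KNil)].

Definition topF (n : nat) : form := FImp (FEq 1 (kv KTop)) (conjF 17 (top_atoms n)).

(* Lists are built with [KHd] and [KTl]; a number is coded by the length of its
   [KTl]-chain, so that [KTl] is also the predecessor and [KNil] also zero. *)
Definition structF : form :=
  FImp (FAnd (FOr (FEq 1 (kv KHd)) (FEq 1 (kv KTl))) (factF 0 1 2 4))
       (FAnd (FNeg (FEq 0 (kv KNil))) (FImp (factF 0 1 3 7) (FEq 2 3))).

(* [rule h k] is a disjunction of conjunctions that must follow from
   H(0, kv k, 2); the empty disjunction forbids such a fact. *)
Definition rule (h : recfun) (k : key) : seq (seq atom) :=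
  match k with
  | KHd | KTl => [:: [::]]
  | KNil | KTop => [::]
  | KGoal => [:: [:: AH 0 (kv (KFun h)) 2]]
  | KNum 0 => [:: [:: AE 2 (kv KNil)]]
  | KNum i.+1 => [:: [:: AH 0 (kv (KNum i)) 10; AH 2 (kv KTl) 10]]
  | KFun RZero => [:: [:: AE 2 (kv KNil)]]
  | KFun RSucc => [:: [:: AH 0 (kv KHd) 10; AH 2 (kv KTl) 10]]
  | KFun (RProj 0) => [:: [:: AH 0 (kv KHd) 2]]
  | KFun (RProj i.+1) =>
      [:: [:: AH 0 (kv KTl) 10; AH 10 (kv (KFun (RProj i))) 2]]
  | KFun (RComp f gs) => [:: [:: AH 0 (kv (KArgs gs)) 10; AH 10 (kv (KFun f)) 2]]
  | KFun (RPrim f g as p) =>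
      [:: [:: AH 0 (kv KHd) (kv KNil); AH 0 (kv KTl) 10; AH 10 (kv (KFun f)) 2];
          [:: AH 0 (kv KHd) 11; AH 0 (kv KTl) 10; AH 11 (kv KTl) 12;
              AH 13 (kv KHd) 12; AH 13 (kv KTl) 10; AH 13 (kv (KFun p)) 14;
              AH 15 (kv KHd) 14; AH 15 (kv KTl) 10;
              AH 16 (kv KHd) 12; AH 16 (kv KTl) 15; AH 16 (kv (KFun g)) 2]]
  | KFun (RMu f) =>
      [:: [:: AH 10 (kv KHd) (kv KNil); AH 10 (kv KTl) 0; AH 10 (kv (KLoop f)) 2]]
  | KLoop f =>
      [:: [:: AH 0 (kv KHd) 2; AH 0 (kv (KFun f)) (kv KNil)];
          [:: AH 0 (kv KHd) 10; AH 0 (kv KTl) 11; AH 0 (kv (KFun f)) 12;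
              AH 12 (kv KTl) 13; AH 14 (kv KTl) 10;
              AH 15 (kv KHd) 14; AH 15 (kv KTl) 11; AH 15 (kv (KLoop f)) 2]]
  | KArgs [::] => [:: [:: AE 2 (kv KNil)]]
  | KArgs (g :: gs) =>
      [:: [:: AH 0 (kv (KFun g)) 10; AH 0 (kv (KArgs gs)) 11;
              AH 2 (kv KHd) 10; AH 2 (kv KTl) 11]]
  end.

(** Every tail of the list is included because the rule of [KArgs] passes to the tail. *)
Definition args_keys (ks : recfun -> seq key) : seq recfun -> seq key :=
  fix go gs := KArgs gs :: if gs is g :: gs' then ks g ++ go gs' else [::].

Fixpoint subkeys (p : recfun) : seq key :=
  KFun p ::
    match p with
    | RZero | RSucc => [::]
    | RProj i => [seq KFun (RProj j) | j <- iota 0 i]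
    | RComp f gs => subkeys f ++ args_keys subkeys gs
    | RPrim f g => subkeys f ++ subkeys g
    | RMu f => KLoop f :: subkeys f
    end.

Fixpoint rulesF (h : recfun) (ks : seq key) : form :=
  if ks is k :: ks' then FAnd (ruleF k (rule h k)) (rulesF h ks') else FNeg FBot.

Definition programF (h : recfun) : form :=
  FAnd structF (rulesF h (KGoal :: subkeys h)).

(* [rule] looks at its program only on [KGoal], so [RZero] is a dummy here. *)
Fixpoint numeralsF (n : nat) : form :=
  FAnd (ruleF (KNum n) (rule RZero (KNum n)))
       (if n is n'.+1 then numeralsF n' else FNeg FBot).

Definition matrixF (B : form) (n : nat) : form := FAnd B (FAnd (topF n) (numeralsF n)).

Fixpoint quant (Q : nat -> form -> form) (b j : nat) (f : form) : form :=
  if j is j'.+1 then Q (b + j') (quant Q b j' f) else f.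

(* Every variable of [M] is at most [encode M], so the sentence is closed. *)
Definition close (M : form) : form :=
  quant FEx 50 (encode M) (quant FAll 0 10 (quant FEx 10 40 M)).

(** * Computing the code of the sentence *)

Fixpoint quant_code (t b j e : nat) : nat :=
  if j is j'.+1 then cpair t (cpair (b + j') (quant_code t b j' e)) else e.

Lemma encode_quant Q t b j f :
  (forall x g, encode (Q x g) = cpair t (cpair x (encode g))) ->
  encode (quant Q b j f) = quant_code t b j (encode f).
Proof. by move=> EQ; elim: j => //= j IH; rewrite EQ IH. Qed.

Lemma computable_kv k F : computable k F -> computable k (fun xs => kv (KNum (F xs))).
Proof.
move=> HF.
suff : computable k (fun xs => 54 + (F xs + F xs)).
  by apply: eq_computable => xs _; rewrite /kv -lock addnn.
by apply: computable_add; [apply: computable_const | apply: computable_add].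
Qed.

Lemma computable_quant_code k t b J F :
  computable k J -> computable k F ->
  computable k (fun xs => quant_code t b (J xs) (F xs)).
Proof.
move=> HJ HF.
have HG : computable k.+2 (fun xs => cpair t (cpair (b + nth 0 xs 0) (nth 0 xs 1))).
  apply: computable_cpair; first exact: computable_const.
  apply: computable_cpair; last exact: computable_proj.
  by apply: computable_add; [apply: computable_const | apply: computable_proj].
apply: eq_computable (computable_iter HJ HF HG) => xs _.
by elim: (J xs) => //= j ->.
Qed.

Ltac computable_template :=
  repeat match goal with
  | |- computable _ (fun _ => ?c) => apply: (computable_const _ c)
  | |- computable _ (fun xs => cpair (@?a xs) (@?b xs)) =>
      apply: (@computable_cpair _ a b)
  | |- computable _ (fun xs => kv (KNum (@?a xs))) => apply: (@computable_kv _ a)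
  end.

Lemma computable_topF k F : computable k F -> computable k (fun xs => encode (topF (F xs))).
Proof. by move=> HF; rewrite /topF /=; computable_template. Qed.

Lemma computable_numeralsF k F :
  computable k F -> computable k (fun xs => encode (numeralsF (F xs))).
Proof.
move=> HF.
have H0 : computable k (fun=> encode (numeralsF 0)) by apply: computable_const.
pose R j := ruleF (KNum j.+1) (rule RZero (KNum j.+1)).
have HS : computable k.+2 (fun xs => cpair 4 (cpair (encode (R (nth 0 xs 0))) (nth 0 xs 1))).
  apply: computable_cpair; first exact: computable_const.
  apply: computable_cpair; last exact: computable_proj.
  rewrite /R /=; computable_template;
    first [exact: computable_proj | by apply: computable_succ; apply: computable_proj].
apply: eq_computable (computable_iter HF H0 HS) => xs _.
by elim: (F xs) => //= j ->.
Qed.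

(** The substitution step of the diagonal argument: the input serves both as the code of [B] and as
    the number [n]. *)
Lemma computable_close_matrixF :
  exists s, forall B, reval s [:: encode B] (encode (close (matrixF B (encode B)))).
Proof.
have Hn := computable_proj (isT : 0 < 1).
pose e xs := cpair 4 (cpair (nth 0 xs 0)
  (encode (FAnd (topF (nth 0 xs 0)) (numeralsF (nth 0 xs 0))))).
have He : computable 1 e.
  apply: computable_cpair; first exact: computable_const.
  apply: computable_cpair; first exact: Hn.
  apply: computable_cpair; first exact: computable_const.
  by apply: computable_cpair; [apply: computable_topF | apply: computable_numeralsF].
have Hq t b c F : computable 1 F -> computable 1 (fun xs => quant_code t b c (F xs)).
  by apply: computable_quant_code; apply: computable_const.
have [s Hs] := computable_quant_code 7 50 He (Hq 8 0 10 _ (Hq 7 10 40 _ He)).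
exists s => B; have := Hs [:: encode B] erefl.
have EE b j f : encode (quant FEx b j f) = quant_code 7 b j (encode f).
  exact: encode_quant.
have EA b j f : encode (quant FAll b j f) = quant_code 8 b j (encode f).
  exact: encode_quant.
by rewrite /close EE EA EE.
Qed.

(** * Free variables and blocks of quantifiers *)

Lemma cpair_ge a b : a + b <= cpair a b.
Proof.
suff H n : n <= n * n.+1 %/ 2.
  by case: b => [|b]; [rewrite /cpair !addn0; apply: H | have := H (a + b.+1); rewrite /cpair; lia].
by elim: n => // n IH; rewrite tri_succ; lia.
Qed.

Lemma fv_le_encode f z : z \in fv f -> z <= encode f.
Proof.
elim: f => [x y|x y||f IH|f IHf g IHg|f IHf g IHg|f IHf g IHg|x f IH|x f IH] //=.
all: rewrite ?inE ?mem_cat ?mem_filter.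
all: try (move=> Hz; apply: leq_trans (cpair_ge _ _); apply: leq_trans (leq_addl _ _)).
- by apply: leq_trans (cpair_ge _ _); case/orP: Hz => /eqP ->; lia.
- by apply: leq_trans (cpair_ge _ _); case/orP: Hz => /eqP ->; lia.
- exact: IH.
- by apply: leq_trans (cpair_ge _ _); case/orP: Hz => [/IHf|/IHg]; lia.
- by apply: leq_trans (cpair_ge _ _); case/orP: Hz => [/IHf|/IHg]; lia.
- by apply: leq_trans (cpair_ge _ _); case/orP: Hz => [/IHf|/IHg]; lia.
- by apply: leq_trans (cpair_ge _ _); case/andP: Hz => _ /IH; lia.
- by apply: leq_trans (cpair_ge _ _); case/andP: Hz => _ /IH; lia.
Qed.

Lemma sat_agree (T : Type) (e : T -> T -> bool) F rho rho' :
  (forall z, z \in fv F -> rho z = rho' z) -> sat e rho F <-> sat e rho' F.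
Proof.
have catP (s t : seq nat) (r r' : nat -> T) : (forall z, z \in s ++ t -> r z = r' z) ->
    (forall z, z \in s -> r z = r' z) /\ (forall z, z \in t -> r z = r' z).
  by move=> E; split=> z Hz; apply: E; rewrite mem_cat Hz ?orbT.
have updP x (s : seq nat) (r r' : nat -> T) a : (forall z, z \in [seq z <- s | z != x] -> r z = r' z) ->
    forall z, z \in s -> upd r x a z = upd r' x a z.
  by move=> E z Hz; rewrite /upd; case: eqP => // /eqP Nz; rewrite E // mem_filter Nz.
elim: F rho rho' => [x y|x y||f IH|f IHf g IHg|f IHf g IHg|f IHf g IHg|x f IH|x f IH]
  rho rho' /= E.
1,2: by rewrite !E // !inE eqxx ?orbT.
- by [].
- by have := IH _ _ E; tauto.
1-3: by have [/IHf Ef /IHg Eg] := catP _ _ _ _ E; tauto.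
- by split=> -[a Ha]; exists a; apply/(IH _ _ (updP _ _ _ _ a E)).
- by split=> Ha a; apply/(IH _ _ (updP _ _ _ _ a E)).
Qed.

Section Quantifiers.
Variables (T : Type) (e : T -> T -> bool).
Implicit Types (rho : nat -> T) (f : form).

Definition agree_off b j rho rho' := forall z, ~~ (b <= z < b + j) -> rho' z = rho z.

Lemma agree_off_S b j rho rho' :
  agree_off b j.+1 rho rho' <-> agree_off b j (upd rho (b + j) (rho' (b + j))) rho'.
Proof.
split=> E z Hz; last first.
  by rewrite E /upd; first case: eqP => // Ez; lia.
by rewrite /upd; case: eqP => [->|Nz] //; apply: E; lia.
Qed.

Lemma sat_exs b j f rho :
  sat e rho (quant FEx b j f) <-> exists rho', agree_off b j rho rho' /\ sat e rho' f.
Proof.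
elim: j rho => [|j IH] rho /=.
  split=> [H|[rho' [E H]]]; first by exists rho.
  by apply/(@sat_agree _ e f rho rho') => [z _|//]; rewrite E //; lia.
split=> [[a /IH[rho' [E H]]]|[rho' [E H]]].
  exists rho'; split=> //; apply/agree_off_S.
  by rewrite (E (b + j)) ?{1}/upd ?eqxx //; lia.
by exists (rho' (b + j)); apply/IH; exists rho'; split=> //; apply/agree_off_S.
Qed.

Lemma sat_alls b j f rho :
  sat e rho (quant FAll b j f) <-> forall rho', agree_off b j rho rho' -> sat e rho' f.
Proof.
elim: j rho => [|j IH] rho /=.
  split=> [H rho' E|H]; last exact: H.
  by apply/(@sat_agree _ e f rho' rho) => [z _|//]; rewrite E //; lia.
split=> [H rho' /agree_off_S E|H a]; first exact: (proj1 (IH _) (H (rho' (b + j))) rho' E).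
apply/IH => rho' E; apply: H; apply/agree_off_S.
by rewrite (E (b + j)) ?{1}/upd ?eqxx //; lia.
Qed.
End Quantifiers.

Lemma mem_fv_quant Q b j f z :
  (forall x g, fv (Q x g) = [seq z <- fv g | z != x]) ->
  (z \in fv (quant Q b j f)) = (z \in fv f) && ~~ (b <= z < b + j).
Proof.
move=> EQ; elim: j => [|j IH] /=; first by rewrite addn0; lia.
by rewrite EQ mem_filter IH; case: (z \in fv f) => /=; lia.
Qed.

Lemma has_prefix_exs p b j f :
  has_prefix (nseq j true ++ p) (quant FEx b j f) = has_prefix p f.
Proof. by elim: j. Qed.

Lemma has_prefix_alls p b j f :
  has_prefix (nseq j false ++ p) (quant FAll b j f) = has_prefix p f.
Proof. by elim: j. Qed.

(** The blocks bind 0 to 9, 10 to 49, and every variable from 50 on that can occur in [M]. *)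
Lemma close_in_class M : qfree M -> in_class 10 40 0 (close M).
Proof.
move=> qM; split; last first.
  exists (encode M); rewrite /prefix_EAEA has_prefix_exs has_prefix_alls has_prefix_exs.
  by case: M qM.
have EE b j f z : (z \in fv (quant FEx b j f)) = (z \in fv f) && ~~ (b <= z < b + j).
  exact: mem_fv_quant.
have EA b j f z : (z \in fv (quant FAll b j f)) = (z \in fv f) && ~~ (b <= z < b + j).
  exact: mem_fv_quant.
rewrite /sentence; case E: (fv (close M)) => [|z s] //.
have : z \in fv (close M) by rewrite E mem_head.
rewrite /close EE EA EE => /andP[/andP[/andP[/fv_le_encode]]]; lia.
Qed.

Lemma qfree_matrixF h n : qfree (matrixF (programF h) n).
Proof.
have qc g s : qfree (conjF g s) by elim: s g => //= -[x k y|x y] s IH g //=.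
have qr k d : qfree (ruleF k d) by rewrite /ruleF /disjF /=; elim: d => //= s d ->; rewrite qc.
have qrs ks : qfree (rulesF h ks) by elim: ks => [|k ks IH] //=; rewrite -/(ruleF _ _) IH andbT; apply: qr.
have qn : qfree (numeralsF n) by elim: n => [|n IH] //=.
rewrite /matrixF /programF.
change (qfree structF && qfree (rulesF h (KGoal :: subkeys h)) && (qfree (topF n) && qfree (numeralsF n))).
by rewrite qrs qn.
Qed.

(** * Rules determine the computed values *)

Section AtomSemantics.
Variables (T : Type) (H : T -> T -> T -> Prop) (rho : nat -> T).

Definition asat (a : atom) : Prop :=
  match a with
  | AH x k y => H (rho x) (rho k) (rho y)
  | AE x y => rho x = rho y
  end.

Fixpoint csat (s : seq atom) : Prop := if s is a :: s' then asat a /\ csat s' else True.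

Fixpoint dsat (d : seq (seq atom)) : Prop :=
  if d is s :: d' then csat s \/ dsat d' else False.

End AtomSemantics.

Fixpoint mem_key (k : key) (ks : seq key) : Prop :=
  if ks is k' :: ks' then k' = k \/ mem_key k ks' else False.

Lemma mem_key_cat k ks ks' : mem_key k (ks ++ ks') <-> mem_key k ks \/ mem_key k ks'.
Proof. by elim: ks => /= [|k0 ks ->]; tauto. Qed.

Section Soundness.
Variables (T : Type) (H : T -> T -> T -> Prop) (c : nat -> T) (h : recfun).

Definition rule_ok (k : key) : Prop :=
  forall x y, H x (c (kv k)) y ->
  exists rho, [/\ rho 0 = x, rho 2 = y, (forall k', rho (kv k') = c (kv k'))
                & dsat H rho (rule h k)].

Let hd x y := H x (c (kv KHd)) y.
Let tl x y := H x (c (kv KTl)) y.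
Let nil := c (kv KNil).

Hypothesis hd_inj : forall x y y', hd x y -> hd x y' -> y = y'.
Hypothesis tl_inj : forall x y y', tl x y -> tl x y' -> y = y'.
Hypothesis tl_nil : forall y, ~ tl nil y.

Fixpoint numeral (v : T) (n : nat) : Prop :=
  if n is n'.+1 then exists u, tl v u /\ numeral u n' else v = nil.

Fixpoint arglist (l : T) (xs : seq nat) : Prop :=
  if xs is x :: xs' then
    exists u l', [/\ hd l u, numeral u x, tl l l' & arglist l' xs']
  else l = nil.

Lemma numeral_tl v u n : numeral v n.+1 -> tl v u -> numeral u n.
Proof. by case=> u' [/tl_inj Hu nu] /Hu <-. Qed.

Lemma numeral_nilS n : ~ numeral nil n.+1.
Proof. by case=> u [/tl_nil]. Qed.

Lemma arglist_hd l x xs u : arglist l (x :: xs) -> hd l u -> numeral u x.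
Proof. by case=> u' [l' [/hd_inj Hu nu _ _]] /Hu <-. Qed.

Lemma arglist_tl l x xs l' : arglist l (x :: xs) -> tl l l' -> arglist l' xs.
Proof. by case=> u [l'' [_ _ /tl_inj Hl al]] /Hl <-. Qed.

Lemma arglist_cons l u l' x xs :
  hd l u -> tl l l' -> numeral u x -> arglist l' xs -> arglist l (x :: xs).
Proof. by move=> *; exists u, l'. Qed.

Ltac use_rule R r x y := let cE := fresh "cE" in move=> /R [r [? ? cE]]; subst x y; rewrite /= ?cE -/nil.

Lemma subkeys_self p : mem_key (KFun p) (subkeys p).
Proof. by case: p => *; left. Qed.

(** Induction on the evaluation. The rules lead from a result back to the values it came from, so a
    model may lack facts, but those it has carry the true value. *)
Lemma numeral_of_reval p xs y : reval p xs y ->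
  (forall k, mem_key k (subkeys p) -> rule_ok k) ->
  forall l v, arglist l xs -> H l (c (kv (KFun p))) v -> numeral v y.
Proof.
pose P p xs y := (forall k, mem_key k (subkeys p) -> rule_ok k) ->
  forall l v, arglist l xs -> H l (c (kv (KFun p))) v -> numeral v y.
pose Q gs xs ys := (forall k, mem_key k (args_keys subkeys gs) -> rule_ok k) ->
  forall l l', arglist l xs -> H l (c (kv (KArgs gs))) l' -> arglist l' ys.
move: p xs y; apply: (@reval_mind P Q).
- move=> xs ok l v _; have R := ok _ (subkeys_self _).
  by use_rule R rho l v => -[[]|//].
- move=> x xs ok l v al; have R := ok _ (subkeys_self _).
  by use_rule R rho l v => -[[Hh [Ht _]]|//]; exists (rho 10); split=> //; apply: arglist_hd al Hh.
- move=> i xs lt ok; have {}ok j : j <= i -> rule_ok (KFun (RProj j)).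
    rewrite leq_eqVlt => /orP[/eqP ->|ltj]; apply: ok; first by left.
    right; have : j \in iota 0 i by rewrite mem_iota.
    elim: (iota 0 i) => //= j' s IH; rewrite inE => /orP[/eqP ->|/IH]; tauto.
  elim: i xs lt ok => [|i IH] [|x xs] //= lt ok l v al; have R := ok _ (leqnn _).
    by use_rule R rho l v => -[[Hh _]|//]; apply: arglist_hd al Hh.
  use_rule R rho l v => -[[Ht [Hp _]]|//]; apply: (IH xs lt) Hp => [j lej|]; first by apply: ok; lia.
  exact: arglist_tl al Ht.
- move=> f gs xs ys y IHgs IHf ok l v al; have R := ok _ (subkeys_self _).
  use_rule R rho l v => -[[Hg [Hf _]]|//].
  apply: (IHf _ _ _ _ Hf) => [k Hk|]; first by apply: ok; right; apply/mem_key_cat; left.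
  by apply: (IHgs _ _ _ al Hg) => k Hk; apply: ok; right; apply/mem_key_cat; right.
- move=> f g xs y IHf ok l v al; have R := ok _ (subkeys_self _).
  use_rule R rho l v => -[[Hh [Ht [Hf _]]]|[[Hh [_ [Hp _]]]|//]]; last first.
    by case: (@tl_nil (rho 12)); rewrite -(arglist_hd al Hh).
  apply: (IHf _ _ _ _ Hf) => [k Hk|]; last exact: arglist_tl al Ht.
  by apply: ok; right; apply/mem_key_cat; left.
- move=> f g n xs r y IHr IHg ok l v al; have R := ok _ (subkeys_self _).
  use_rule R rho l v => -[[Hh _]|[[Hh [Ht [Hp [h3 [t3 [Hr [h5 [t5 [h6 [t6 [Hg _]]]]]]]]]]]|//]].
    by case: (@numeral_nilS n); apply: arglist_hd al Hh.
  (* Variables 13, 15 and 16 of the rule hold the lists [n :: xs], [r :: xs] and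
     [[:: n, r & xs]]. *)
  have nn := numeral_tl (arglist_hd al Hh) Hp; have axs := arglist_tl al Ht.
  have nr := IHr ok _ _ (arglist_cons h3 t3 nn axs) Hr.
  apply: (IHg _ _ _ (arglist_cons h6 t6 nn (arglist_cons h5 t5 nr axs)) Hg) => k Hk.
  by apply: ok; right; apply/mem_key_cat; right.
- move=> f xs y IHf IHlt ok l v al; have R := ok _ (subkeys_self _).
  have okf k : mem_key k (subkeys f) -> rule_ok k by move=> Hk; apply: ok; right; right.
  have {ok} Rl : rule_ok (KLoop f) by apply: ok; right; left.
  (* Induction on the distance from the candidate [z] to the least zero [y]. Before [y] the value of
     [f] is a successor, which excludes the stopping disjunct; at [y] it is zero, which excludes the
     continuing one. *)
  suff loop d : forall z, z + d = y -> forall l v, arglist l (z :: xs) ->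
      H l (c (kv (KLoop f))) v -> numeral v y.
    use_rule R rho l v => -[[Hh [Ht [Hl _]]]|//].
    exact: loop (add0n y) _ _ (arglist_cons Hh Ht (erefl _ : numeral nil 0) al) Hl.
  elim: d {R l v al} => [|d IH] z Ez l v al.
    move: Ez; rewrite addn0 => Ez; rewrite {}Ez in al.
    use_rule Rl rho l v => -[[Hh _]|[[_ [_ [Hf [Ht _]]]]|//]].
      exact: arglist_hd al Hh.
    by have E := IHf okf _ _ al Hf; rewrite E in Ht; case: (tl_nil Ht).
  have [k IHk] : exists k, P f (z :: xs) k.+1 by apply: IHlt; lia.
  use_rule Rl rho l v => -[[_ [Hf _]]|[[Hh [Ht [_ [_ [Hs [h5 [t5 [Hl _]]]]]]]]|//]].
    by case: (numeral_nilS (IHk okf _ _ al Hf)).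
  apply: (IH z.+1 _ _ _ _ Hl); first by lia.
  apply: arglist_cons h5 t5 _ (arglist_tl al Ht).
  by exists (rho 10); split=> //; apply: arglist_hd al Hh.
- move=> xs ok l v _; have R := ok _ (or_introl erefl).
  by use_rule R rho l v => -[[]|//].
- move=> g gs xs y ys IHg IHgs ok l v al; have R := ok _ (or_introl erefl).
  use_rule R rho l v => -[[Hg [Hgs [Hh [Ht _]]]]|//]; apply: arglist_cons Hh Ht _ _.
    by apply: (IHg _ _ _ al Hg) => k Hk; apply: ok; right; apply/mem_key_cat; left.
  by apply: (IHgs _ _ _ al Hgs) => k Hk; apply: ok; right; apply/mem_key_cat; right.
Qed.

Lemma numeral_of_KNum n : (forall i, i <= n -> rule_ok (KNum i)) ->
  forall x v, H x (c (kv (KNum n))) v -> numeral v n.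
Proof.
elim: n => [|n IH] ok x v; have R := ok _ (leqnn _).
  by use_rule R rho x v => -[[]|//].
use_rule R rho x v => -[[Hn [Ht _]]|//]; exists (rho 10); split=> //.
by apply: IH Hn => i lei; apply: ok; lia.
Qed.

(** The top atoms claim the value 0, whereas an evaluation to [y.+1] would make nil a numeral of
    [y.+1]. *)
Lemma not_reval_succ n rho y :
  (forall k, mem_key k (KGoal :: subkeys h) -> rule_ok k) ->
  (forall i, i <= n -> rule_ok (KNum i)) ->
  (forall k, rho (kv k) = c (kv k)) -> csat H rho (top_atoms n) ->
  ~ reval h [:: n] y.+1.
Proof.
move=> ok okN cE; rewrite /= !cE -/nil => -[Hn [Hh [Ht [Hg _]]]] ev.
have al : arglist (rho 11) [:: n].
  exact: arglist_cons Hh Ht (numeral_of_KNum okN Hn) (erefl : arglist nil [::]).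
have [rho' [E0 E2 cE' [[]|//]]] := ok KGoal (or_introl erefl) _ _ Hg.
rewrite /= E0 E2 cE' => Hp _.
apply: (@numeral_nilS y); apply: (numeral_of_reval ev _ al Hp) => k Hk.
by apply: ok; right.
Qed.

End Soundness.

(** * Reading the sentence in an arbitrary graph *)

Section GraphFacts.
Variables (T : Type) (e : T -> T -> bool).
Implicit Types rho c : nat -> T.

Fixpoint adjacent (s : seq (T * T)) : Prop :=
  if s is p :: s' then e p.1 p.2 /\ adjacent s' else True.

Definition gadget c (x k y g1 g2 g3 : T) : Prop :=
  adjacent [:: (x, c 53); (k, c 53); (y, c 53); (g1, c 50); (g2, c 51); (g3, c 52);
               (g1, x); (g2, k); (g3, y); (g1, g2); (g2, g3)].

Definition gfact c x k y : Prop := exists g1 g2 g3, gadget c x k y g1 g2 g3.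

Definition extends c rho := forall z, 50 <= z -> rho z = c z.

Lemma sat_factF c rho x k y g : extends c rho ->
  sat e rho (factF x k y g) <->
  gadget c (rho x) (rho k) (rho y) (rho g) (rho g.+1) (rho g.+2).
Proof. by move=> E; rewrite /gadget /= -!E //; tauto. Qed.

Lemma csat_of_conjF c rho g s : extends c rho ->
  sat e rho (conjF g s) -> csat (gfact c) rho s.
Proof.
move=> E; elim: s g => //= a s IH g [Ha /IH Hs]; split=> //.
by case: a Ha => [x k y /(sat_factF _ _ _ _ E)|//]; exists (rho g), (rho g.+1), (rho g.+2).
Qed.

Lemma dsat_of_disjF c rho d : extends c rho ->
  sat e rho (disjF d) -> dsat (gfact c) rho d.
Proof. by move=> E; elim: d => //= s d IH [/(csat_of_conjF E)|/IH]; [left|right]. Qed.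

Lemma sat_rulesF rho h ks : sat e rho (rulesF h ks) <->
  forall k, mem_key k ks -> sat e rho (ruleF k (rule h k)).
Proof.
elim: ks => [|k ks IH]; first by split=> // _ [].
split=> [[Hk /IH Hks] k' [<-|]|Hk] //; first exact: Hks.
by split; [apply: Hk; left | apply/IH => k' Hk'; apply: Hk; right].
Qed.

Lemma sat_numeralsF rho n : sat e rho (numeralsF n) <->
  forall i, i <= n -> sat e rho (ruleF (KNum i) (rule RZero (KNum i))).
Proof.
elim: n => [|n IH].
  by split=> [[H _] [|i] //|H]; split=> //; apply: H.
split=> [[Hn /IH Hi] i|H].
  by rewrite leq_eqVlt => /orP[/eqP -> //|]; apply: Hi.
by split; [apply: H | apply/IH => i lei; apply: H; lia].
Qed.

Lemma sat_close M rho : sat e rho (close M) <->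
  exists c, agree_off 50 (encode M) rho c /\
    forall rho0, agree_off 0 10 c rho0 ->
    exists rho1, agree_off 10 40 rho0 rho1 /\ sat e rho1 M.
Proof.
split=> [/sat_exs[c [E /sat_alls S]]|[c [E S]]].
  by exists c; split=> // rho0 /S/sat_exs.
by apply/sat_exs; exists c; split=> //; apply/sat_alls => rho0 /S/sat_exs.
Qed.

(** Suitable instances of the universal block yield the list axioms, the rules and the top atoms for
    the relation [gfact]. *)
Lemma not_sat_close h n y rho :
  sat e rho (close (matrixF (programF h) n)) -> ~ reval h [:: n] y.+1.
Proof.
move=> Sc; have [c [_ Hc]] := proj1 (sat_close (matrixF (programF h) n) rho) Sc => {Sc}.
(* The list [s] prescribes the universal variables from 0 on; those past its end keep their values
   under [c]. *)
have {Hc} M s : size s <= 10 -> exists rho1,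
    [/\ forall z, z < 10 -> rho1 z = nth (c z) s z, extends c rho1
      & sat e rho1 (matrixF (programF h) n)].
  move=> szs; have /Hc[rho1 [A S]] : agree_off 0 10 c (fun z => nth (c z) s z).
    by move=> z Hz; rewrite nth_default //; lia.
  exists rho1; split=> // z lez; rewrite A //; try lia.
  by rewrite nth_default //; lia.
have kvE rho1 k : extends c rho1 -> rho1 (kv k) = c (kv k).
  by apply; have := kv_ge k; lia.
have struct x k v : k = c (kv KHd) \/ k = c (kv KTl) -> gfact c x k v ->
    x <> c (kv KNil) /\ forall v', gfact c x k v' -> v = v'.
  move=> Hk [g1 [g2 [g3 G]]].
  have S v' g1' g2' g3' : gadget c x k v' g1' g2' g3' -> x <> c (kv KNil) /\ v = v'.
    (* This instance uses all ten universal variables: two facts that share [x] and [k], with a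
       gadget for each. *)
    move=> G'; have [//|rho1 [A E [[St _] _]]] := M [:: x; k; v; v'; g1; g2; g3; g1'; g2'; g3'].
    case: (St : sat e rho1 structF) => [|S S'].
      split; first by rewrite /= !kvE // !A.
      by apply/(sat_factF _ _ _ _ E); rewrite !A.
    split; first by move: S; rewrite /= kvE // A.
    suff /S' : sat e rho1 (factF 0 1 3 7) by rewrite /= !A.
    by apply/(sat_factF _ _ _ _ E); rewrite !A.
  split; first by case: (S _ _ _ _ G).
  by move=> v' [g1' [g2' [g3' /S[]]]].
have ok k : mem_key k (KGoal :: subkeys h) \/ (exists2 i, i <= n & k = KNum i) ->
    rule_ok (gfact c) c h k.
  move=> Hk x v [g1 [g2 [g3 G]]].
  have [//|rho1 [A E [[_ Sr] [_ Sn]]]] := M [:: x; c (kv k); v; v; g1; g2; g3].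
  have {Sr Sn} : sat e rho1 (ruleF k (rule h k)).
    case: Hk => [Hk|[i lei ->]]; first exact: (proj1 (sat_rulesF rho1 h (KGoal :: subkeys h)) Sr k Hk).
    by have := proj1 (sat_numeralsF rho1 n) Sn _ lei; case: (i).
  move=> S; exists rho1; rewrite !A //; split=> //; first by move=> k'; apply: kvE.
  apply: (dsat_of_disjF E); apply: S; split; first by rewrite /= kvE // A.
  by apply/(sat_factF _ _ _ _ E); rewrite !A.
have [//|rho1 [A E [_ [St _]]]] := M [:: c 0; c (kv KTop)].
apply: (@not_reval_succ _ (gfact c) c h _ _ _ n rho1) => [x v v'|x v v'|v|k|i|k|].
- by move=> /struct[|_ S /S]; first by left.
- by move=> /struct[|_ S /S]; first by right.
- by case/struct; first by right.
- by move=> Hk; apply: ok; left.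
- by move=> lei; apply: ok; right; exists i.
- exact: kvE.
- apply: (csat_of_conjF E); apply: St; rewrite /= kvE // A //.
Qed.
End GraphFacts.

(** * The finite set of facts behind a computation *)

(* Values of the intended model: [inl xs] is a list of numbers, the number n
   being the list [nseq n 0] itself; [inr z] is the constant named by variable z. *)
Definition value : Type := (seq nat + nat)%type.
Definition num (n : nat) : value := inl (nseq n 0).
Definition cst (z : nat) : value := if z == kv KNil then inl [::] else inr z.
Definition holds (L : seq (value * value * value)) (x k y : value) : Prop := (x, k, y) \in L.

Lemma cst_kv k : cst (kv k) = if k is KNil then inl [::] else inr (kv k).
Proof. by rewrite /cst; case: eqP => [/kv_inj ->|] //; case: k. Qed.

Lemma csat_mono T (H H' : T -> T -> T -> Prop) rho s :
  (forall x k y, H x k y -> H' x k y) -> csat H rho s -> csat H' rho s.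
Proof. by move=> HH'; elim: s => //= -[x k y|x y] s IH /= [? /IH]; split=> //; apply: HH'. Qed.

Lemma dsat_mono T (H H' : T -> T -> T -> Prop) rho d :
  (forall x k y, H x k y -> H' x k y) -> dsat H rho d -> dsat H' rho d.
Proof. by move=> HH'; elim: d => //= s d IH [/(csat_mono HH')|/IH]; [left|right]. Qed.

Section Completeness.
Variable h : recfun.

(** The rules of [KHd] and [KTl] are trivially true, so this clause is what later yields
    [structF]. *)
Definition list_fact (k : key) (x y : value) : Prop :=
  match k with
  | KHd => exists n xs, x = inl (n :: xs) /\ y = num n
  | KTl => exists n xs, x = inl (n :: xs) /\ y = inl xs
  | _ => True
  end.

Definition supported L (x z y : value) : Prop :=
  exists k rho, [/\ z = inr (kv k), list_fact k x y, rho 0 = x /\ rho 2 = y,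
    forall z, 50 <= z -> rho z = cst z & dsat (holds L) rho (rule h k)].

Definition good L := forall x z y, holds L x z y -> supported L x z y.

(** Good sets are closed under union, so finitely many derivable facts lie in one finite good set,
    from which the model is built. *)
Definition derivable (x z y : value) : Prop := exists L, good L /\ holds L x z y.

Lemma supported_mono L L' x z y :
  {subset L <= L'} -> supported L x z y -> supported L' x z y.
Proof.
move=> sLL' [k [rho [? ? ? ? Hd]]]; exists k, rho; split=> //.
by apply: dsat_mono Hd => x' k' y'; apply: sLL'.
Qed.

Lemma good_cat L L' : good L -> good L' -> good (L ++ L').
Proof.
move=> gL gL' x z y; rewrite /holds mem_cat => /orP[/gL|/gL']; apply: supported_mono.
  by move=> t Ht; rewrite mem_cat Ht.
by move=> t Ht; rewrite mem_cat Ht orbT.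
Qed.

Lemma good_of_csat rho s :
  csat derivable rho s -> exists L, good L /\ csat (holds L) rho s.
Proof.
elim: s => [_|a s IH /= [Ha /IH[L [gL HL]]]]; first by exists [::].
have [L' [gL' HL']] : exists L', good L' /\ asat (holds L') rho a.
  by case: a Ha => [x k y [L']|x y E] //; [exists L' | exists [::]].
exists (L ++ L'); split; first exact: good_cat.
split; last by apply: csat_mono HL => x k y; rewrite /holds mem_cat => ->.
by case: a HL' {Ha} => //= x k y; rewrite /holds mem_cat => ->; rewrite orbT.
Qed.

Lemma good_of_dsat rho d :
  dsat derivable rho d -> exists L, good L /\ dsat (holds L) rho d.
Proof.
elim: d => //= s d IH [/good_of_csat|/IH] [L [gL HL]]; exists L; split=> //; first by left.
by right.
Qed.

(** The new fact is added to a good set containing the atoms of a disjunct. Variables 10 to 16 take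
    the values [w0] to [w6]; [rho] is given by equations so that applications only rewrite. *)
Lemma derivable_rule k x y w0 w1 w2 w3 w4 w5 w6 :
  list_fact k x y ->
  (forall rho, rho 0 = x -> rho 2 = y ->
    rho 10 = w0 -> rho 11 = w1 -> rho 12 = w2 -> rho 13 = w3 ->
    rho 14 = w4 -> rho 15 = w5 -> rho 16 = w6 ->
    (forall k, rho (kv k) = if k is KNil then inl [::] else inr (kv k)) ->
    dsat derivable rho (rule h k)) ->
  derivable x (inr (kv k)) y.
Proof.
move=> lf; set nl : value := inl [::].
pose s := [:: x; nl; y; nl; nl; nl; nl; nl; nl; nl; w0; w1; w2; w3; w4; w5; w6].
pose rho z := nth (cst z) s z.
have rhoE z : 50 <= z -> rho z = cst z.
  by move=> lez; rewrite /rho nth_default //=; lia.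
move=> /(_ rho) H; have {H} [|L [gL HL]] := good_of_dsat (H erefl erefl erefl erefl erefl erefl erefl erefl erefl _).
  by move=> k'; rewrite rhoE ?cst_kv //; have := kv_ge k'; lia.
have sL : {subset L <= (x, inr (kv k), y) :: L} by move=> t Ht; rewrite inE Ht orbT.
exists ((x, inr (kv k), y) :: L); split; last exact: mem_head.
move=> x' z' y'; rewrite /holds inE => /orP[/eqP[-> -> ->]|/gL]; last exact: supported_mono.
by apply: (supported_mono sL); exists k, rho; split.
Qed.

Lemma derivable_hd n xs : derivable (inl (n :: xs)) (inr (kv KHd)) (num n).
Proof.
pose o := num 0; apply: (derivable_rule (w0 := o) (w1 := o) (w2 := o) (w3 := o)
  (w4 := o) (w5 := o) (w6 := o)) => [|*]; last by left.
by exists n, xs.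
Qed.

Lemma derivable_tl n xs : derivable (inl (n :: xs)) (inr (kv KTl)) (inl xs).
Proof.
pose o := num 0; apply: (derivable_rule (w0 := o) (w1 := o) (w2 := o) (w3 := o)
  (w4 := o) (w5 := o) (w6 := o)) => [|*]; last by left.
by exists n, xs.
Qed.

Lemma derivable_pred n : derivable (num n.+1) (inr (kv KTl)) (num n).
Proof. exact: derivable_tl. Qed.

Lemma derivable_hd0 xs : derivable (inl (0 :: xs)) (inr (kv KHd)) (inl [::]).
Proof. exact: derivable_hd. Qed.

Ltac fire w0 w1 w2 w3 w4 w5 w6 :=
  let E0 := fresh in let E2 := fresh in let E10 := fresh in let E11 := fresh in
  let E12 := fresh in let E13 := fresh in let E14 := fresh in let E15 := fresh in
  let E16 := fresh in let Ek := fresh in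
  apply: (derivable_rule (w0 := w0) (w1 := w1) (w2 := w2) (w3 := w3)
    (w4 := w4) (w5 := w5) (w6 := w6)) => // ? E0 E2 E10 E11 E12 E13 E14 E15 E16 Ek;
  rewrite /= ?(E0, E2, E10, E11, E12, E13, E14, E15, E16, Ek).

(** Counterpart of [numeral_of_reval]: each step of an evaluation is one application of a rule, with
    explicit witnesses. *)
Lemma derivable_reval p xs y :
  reval p xs y -> derivable (inl xs) (inr (kv (KFun p))) (num y).
Proof.
pose P p xs y := derivable (inl xs) (inr (kv (KFun p))) (num y).
pose Q gs xs ys := derivable (inl xs) (inr (kv (KArgs gs))) (inl ys).
pose o := num 0; pose l xs : value := inl xs.
have [dh dt] := (derivable_hd, derivable_tl).
have [dp dh0] := (derivable_pred, derivable_hd0).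
move: p xs y; apply: (@reval_mind P Q); rewrite /P /Q.
- by move=> xs; fire o o o o o o o; left.
- by move=> x xs; fire (num x) o o o o o o; left; do !split.
- elim=> [|i IH] [|x xs] //= lt.
    by fire o o o o o o o; left; do !split.
  by fire (l xs) o o o o o o; left; do !split; last apply: IH.
- by move=> f gs xs ys y Hgs Hf; fire (l ys) o o o o o o; left.
- by move=> f g xs y Hf; fire (l xs) o o o o o o; left; do !split.
- move=> f g n xs r y Hr Hg.
  fire (l xs) (num n.+1) (num n) (l (n :: xs)) (num r) (l (r :: xs)) (l [:: n, r & xs]).
  by right; left; do !split.
- move=> f xs y Hf Hlt.
  have loop d : forall z, z + d = y -> derivable (inl (z :: xs)) (inr (kv (KLoop f))) (num y).
    elim: d => [|d IH] z Ez.
      by rewrite -Ez addn0 in Hf *; fire o o o o o o o; left; do !split.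
    have [k Hk] : exists k, derivable (inl (z :: xs)) (inr (kv (KFun f))) (num k.+1).
      by apply: Hlt; lia.
    fire (num z) (l xs) (num k.+1) (num k) (num z.+1) (l (z.+1 :: xs)) o.
    by right; left; do !split=> //; apply: IH; lia.
  by fire (l (0 :: xs)) o o o o o o; left; do !split => //; apply: loop.
- by move=> xs; fire o o o o o o o; left.
- by move=> g gs xs y ys Hg Hgs; fire (num y) (l ys) o o o o o; left; do !split.
Qed.

Lemma derivable_KNum n x : derivable x (inr (kv (KNum n))) (num n).
Proof.
pose o := num 0; have dp := derivable_pred.
elim: n => [|n IH]; first by fire o o o o o o o; left.
by fire (num n) o o o o o o; left; do !split.
Qed.

Lemma derivable_goal l v :
  derivable l (inr (kv (KFun h))) v -> derivable l (inr (kv KGoal)) v.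
Proof. by pose o := num 0; move=> Hh; fire o o o o o o o; left. Qed.

End Completeness.

(** * Encoding a ternary relation in a graph *)

(* Variables that the rules may mention; 0 and 2 only when [b] holds. *)
Definition okvar (b : bool) (z : nat) : bool :=
  [|| b && ((z == 0) || (z == 2)), 10 <= z < 17 | 54 <= z].

Arguments okvar : simpl never.

Definition okatom b (a : atom) : bool :=
  match a with
  | AH x k y => [&& okvar b x, okvar b k & okvar b y]
  | AE x y => okvar b x && okvar b y
  end.

Definition okrule b (d : seq (seq atom)) : bool :=
  all (fun s => (size s <= 11) && all (okatom b) s) d.

Lemma okvar_kv b k : okvar b (kv k).
Proof. by rewrite /okvar kv_ge !orbT. Qed.

Lemma okrule_rule h k : okrule true (rule h k).
Proof.
have H := okvar_kv true.
case: k => [|||||[|i]|[||[|i]|f gs|f g|f]|[|g gs]|f] //; by rewrite /okrule /= !H.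
Qed.

Lemma okrule_top n : okrule false [:: top_atoms n].
Proof. by rewrite /okrule /=. Qed.

Section Gadgets.
Variables (T : Type) (e : T -> T -> bool) (c : nat -> T).

(** Gadgets are chosen atom by atom; their variables lie among 17 to 49, which [okvar] excludes from
    the atoms, so no choice disturbs another atom. *)
Lemma sat_conjF_intro b s g rho :
  all (okatom b) s -> 17 <= g -> 3 * size s + g <= 50 -> extends c rho ->
  csat (gfact e c) rho s ->
  exists rho', agree_off g (3 * size s) rho rho' /\ sat e rho' (conjF g s).
Proof.
elim: s g rho => [|a s IH] g rho /=; first by exists rho; split.
move=> /andP[oka oks] leg les E [Ha Hs].
pose rho1 g1 g2 g3 z := if z == g then g1 else if z == g.+1 then g2 else
  if z == g.+2 then g3 else rho z.
have okE z g1 g2 g3 : okvar b z -> rho1 g1 g2 g3 z = rho z.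
  by move=> okz; rewrite /rho1 !ifN //; move: okz; rewrite /okvar; lia.
have [g1 [g2 [g3 Hg]]] : exists g1 g2 g3,
    if a is AH x k y then gadget e c (rho x) (rho k) (rho y) g1 g2 g3 else True.
  by case: a Ha {oka} => // x y _; exists (rho 0), (rho 0), (rho 0).
have E1 : extends c (rho1 g1 g2 g3) by move=> z lez; rewrite /rho1 !ifN ?E //; lia.
have [| | |rho' [A S]] := IH (3 + g) (rho1 g1 g2 g3) oks _ _ E1; [lia | lia | |].
  elim: s oks Hs {IH les} => //= a' s IH /andP[oka' oks] [Ha' /(IH oks)]; split=> //.
  by case: a' oka' Ha' => [x k y /and3P[*]|x y /andP[*]] /=; rewrite !okE.
exists rho'; split; first by move=> z Hz; rewrite A /rho1 ?ifN //; lia.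
split=> //; have okE' z : okvar b z -> rho' z = rho z.
  by move=> okz; rewrite A ?okE //; move: okz; rewrite /okvar; lia.
have E' : extends c rho' by move=> z lez; rewrite A ?E1 //; lia.
case: a oka Ha Hg => [x k y /and3P[okx okk oky] _ Hg|x y /andP[okx oky] Ha _] /=.
  apply/(sat_factF _ _ _ _ _ E'); rewrite (okE' _ okx) (okE' _ okk) (okE' _ oky) !A; try lia.
  rewrite /rho1 !eqxx; have -> : (g.+1 == g) = false by lia.
  have -> : (g.+2 == g) = false by lia.
  by have -> : (g.+2 == g.+1) = false by lia.
by rewrite !okE'.
Qed.

Lemma sat_disjF_intro b d rho :
  okrule b d -> extends c rho -> dsat (gfact e c) rho d ->
  exists rho', agree_off 17 33 rho rho' /\ sat e rho' (disjF d).
Proof.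
move=> okd E; elim: d okd => //= s d IH /andP[/andP[szs oks] okd] [Hs|/(IH okd)]; last first.
  by case=> rho' [A S]; exists rho'; split=> //; right.
have [|//|rho' [A S]] := sat_conjF_intro (g := 17) oks _ _ E Hs; [by lia | by lia |].
by exists rho'; split; [move=> z Hz; apply: A; lia | left].
Qed.

End Gadgets.

Section TripleGraph.
Variables (A : finType) (H : A -> A -> A -> bool).

(** Four markers, the elements, and three vertices per triple; by [arc], the vertices of a triple
    outside [H] are isolated. *)
Definition vertex : finType := ('I_4 + A + A * A * A * 'I_3)%type.
Definition mark (m : nat) : vertex := inl (inl (inord m)).
Definition elt (a : A) : vertex := inl (inr a).
Definition trip (t : A * A * A) (i : 'I_3) : vertex := inr (t, i).

Definition coord (t : A * A * A) (i : nat) : A :=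
  match i with 0 => t.1.1 | 1 => t.1.2 | _ => t.2 end.

Definition arc (x y : vertex) : bool :=
  match x, y with
  | inl (inr _), inl (inl m) => m == 3 :> nat
  | inr (t, i), inl (inl m) => H t.1.1 t.1.2 t.2 && (i == m :> nat)
  | inr (t, i), inl (inr a) => H t.1.1 t.1.2 t.2 && (coord t i == a)
  | inr (t, i), inr (t', j) => [&& H t.1.1 t.1.2 t.2, t == t' & j == i.+1 :> nat]
  | _, _ => false
  end.

Definition adj (x y : vertex) : bool := arc x y || arc y x.

Lemma adj_irr : irreflexive adj.
Proof. by case=> [[m|a]|[t i]] //; rewrite /adj /= orbb; lia. Qed.

Lemma adj_sym : symmetric adj.
Proof. by move=> x y; rewrite /adj orbC. Qed.

Lemma adj_mark x m : m < 4 -> adj x (mark m) ->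
  (exists a, x = elt a /\ m = 3) \/
  (exists t (i : 'I_3), [/\ x = trip t i, H t.1.1 t.1.2 t.2 & i = m :> nat]).
Proof.
move=> ltm; case: x => [[m'|a]|[t i]]; rewrite /adj /= ?orbF ?inordK //.
- by move/eqP; left; exists a.
- by case/andP=> Ht /eqP; right; exists t, i.
Qed.

Variable c : nat -> vertex.
Hypothesis c50 : forall i, i < 4 -> c (50 + i) = mark i.

Lemma gfact_elt a k b : H a k b -> gfact adj c (elt a) (elt k) (elt b).
Proof.
move=> Hakb; exists (trip (a, k, b) (inord 0)), (trip (a, k, b) (inord 1)), (trip (a, k, b) (inord 2)).
rewrite /gadget (c50 (isT : 3 < 4)) (c50 (isT : 2 < 4)) (c50 (isT : 1 < 4)) (c50 (isT : 0 < 4)).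
by rewrite /adjacent /adj /= !inordK //= !Hakb !eqxx.
Qed.

(** The graph has no accidental gadgets: the markers fix the kind of each vertex, and the path edges
    put the three gadget vertices into one triple. *)
Lemma elt_gfact x k y : gfact adj c x k y ->
  exists a b d, [/\ x = elt a, k = elt b, y = elt d & H a b d].
Proof.
case=> g1 [g2 [g3]].
rewrite /gadget (c50 (isT : 3 < 4)) (c50 (isT : 2 < 4)) (c50 (isT : 1 < 4)) (c50 (isT : 0 < 4)) /=.
case=> /adj_mark[//|[a [-> _]]|[t [i [_ _]]]]; last by have := ltn_ord i; lia.
case=> /adj_mark[//|[b [-> _]]|[t [i [_ _]]]]; last by have := ltn_ord i; lia.
case=> /adj_mark[//|[d [-> _]]|[t [i [_ _]]]]; last by have := ltn_ord i; lia.
case=> /adj_mark[//|[? []]|[t1 [i1 [-> H1 E1]]]] //.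
case=> /adj_mark[//|[? []]|[t2 [i2 [-> H2 E2]]]] //.
case=> /adj_mark[//|[? []]|[t3 [i3 [-> H3 E3]]]] //.
rewrite /adj /= !orbF E1 E2 E3 H1 H2 H3 /=.
case=> /eqP Ea [/eqP Eb [/eqP Ed [E12 [E23 _]]]].
have {}E12 : t1 = t2 by move: E12; rewrite andbF orbF andbT => /eqP.
have {}E23 : t2 = t3 by move: E23; rewrite andbF orbF andbT => /eqP.
by exists a, b, d; rewrite -Ea -Eb -Ed E12 E23.
Qed.

End TripleGraph.

(** * The finite model *)

Lemma sat_sentence (T : Type) (e : T -> T -> bool) f rho rho' :
  sentence f -> sat e rho f -> sat e rho' f.
Proof.
move=> /nilP cl S; apply: (proj1 (@sat_agree _ e f rho rho' _) S).
by move=> z; rewrite cl.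
Qed.

(** Being closed, [close M] may be evaluated at [c] itself, where the leading existential variables
    keep their values. *)
Lemma sat_close_intro (T : Type) (e : T -> T -> bool) M c rho : qfree M ->
  (forall rho0, agree_off 0 10 c rho0 ->
    exists rho1, agree_off 10 40 rho0 rho1 /\ sat e rho1 M) ->
  sat e rho (close M).
Proof.
move=> qM S; apply: (@sat_sentence _ _ _ c); first by case: (close_in_class qM).
by apply/sat_close; exists c.
Qed.

Lemma extends_agree T (c rho0 rho1 : nat -> T) :
  agree_off 0 10 c rho0 -> agree_off 10 40 rho0 rho1 -> extends c rho1.
Proof. by move=> A0 A1 z lez; rewrite A1 ?A0 //; lia. Qed.

Lemma mem_key_map k ks : mem_key k ks -> cst (kv k) \in [seq cst (kv k) | k <- ks].
Proof. by elim: ks => //= k' ks IH [->|/IH]; rewrite inE ?eqxx // => ->; rewrite orbT. Qed.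

Section FiniteModel.
Variables (h : recfun) (n : nat) (L : seq (value * value * value)).
Hypothesis gL : good h L.

Definition is_rule_key (k : key) : Prop :=
  mem_key k (KGoal :: subkeys h) \/ (exists2 i, i <= n & k = KNum i).

Definition named : seq value :=
  inl [::] :: [seq cst (kv k) | k <- [:: KHd, KTl, KTop, KGoal & subkeys h]]
    ++ [seq cst (kv (KNum i)) | i <- iota 0 n.+1].

Definition support : seq value :=
  named ++ flatten [seq [:: t.1.1; t.1.2; t.2] | t <- L].

Definition carrier : finType := seq_sub support.

Definition fact_rel (a k b : carrier) : bool := (val a, val k, val b) \in L.

Lemma nil_support : inl [::] \in support. Proof. exact: mem_head. Qed.

(** Values outside [support] collapse to the empty list, which is why [kv_support_inj] asks for
    membership. *)
Definition to_carrier (v : value) : carrier := insubd (SeqSub nil_support) v.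

Lemma val_to_carrier v : v \in support -> val (to_carrier v) = v.
Proof. exact: insubdK. Qed.

Lemma holds_support x k y : holds L x k y ->
  [/\ x \in support, k \in support & y \in support].
Proof.
move=> Ht; have S v : v \in [:: x; k; y] -> v \in support.
  move=> Hv; rewrite mem_cat; apply/orP; right; apply/flatten_mapP.
  by exists (x, k, y).
by split; apply: S; rewrite !inE eqxx ?orbT.
Qed.

Lemma rule_key_support k : is_rule_key k -> cst (kv k) \in support.
Proof.
move=> Hk; rewrite mem_cat; apply/orP; left; rewrite inE mem_cat; apply/orP; right.
case: Hk => [Hk|[i lei ->]]; apply/orP; [left|right].
  by apply: mem_key_map; right; right; right; case: Hk; [left|right].
by apply/mapP; exists i; rewrite ?mem_iota.
Qed.

Definition gval (z : nat) : vertex carrier :=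
  if z < 54 then mark carrier (z - 50) else elt (to_carrier (cst z)).

Lemma gval_mark i : i < 4 -> gval (50 + i) = mark carrier i.
Proof. by move=> lti; rewrite /gval addKn ifT //; lia. Qed.

Lemma gval_kv k : gval (kv k) = elt (to_carrier (cst (kv k))).
Proof. by rewrite /gval ltnNge kv_ge. Qed.

Let e : rel (vertex carrier) := adj fact_rel.

Lemma gfact_supported x k y : gfact e gval x k y ->
  exists a b d, [/\ x = elt a, k = elt b, y = elt d & supported h L (val a) (val b) (val d)].
Proof.
by case/(elt_gfact gval_mark) => a [b [d [-> -> -> /gL S]]]; exists a, b, d.
Qed.

Lemma kv_support_inj b k k' : cst (kv k) \in support ->
  elt b = gval (kv k) -> val b = inr (kv k') -> k' = k.
Proof.
move=> Sk; rewrite gval_kv => -[->]; rewrite val_to_carrier // cst_kv.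
by case: k {Sk} => // *; apply: kv_inj; congruence.
Qed.

(** Carries a disjunction from the values to the graph: the witnesses 10 to 16 become elements, and
    the gadgets are then added. *)
Lemma transfer (b : bool) rhoU rho0 d :
  (forall z, 50 <= z -> rhoU z = cst z) -> agree_off 0 10 gval rho0 ->
  (b -> rho0 0 = elt (to_carrier (rhoU 0)) /\ rho0 2 = elt (to_carrier (rhoU 2))) ->
  okrule b d -> dsat (holds L) rhoU d ->
  exists rho1, agree_off 10 40 rho0 rho1 /\ sat e rho1 (disjF d).
Proof.
move=> EU E0 Eb okd Hd.
pose rho z := if 10 <= z < 17 then elt (to_carrier (rhoU z)) else rho0 z.
have rhoE z : okvar b z -> rho z = elt (to_carrier (rhoU z)).
  rewrite /okvar /rho; case/or3P => [/andP[/Eb[E1 E2] /orP[] /eqP->]|->|lez] //.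
  have -> : (10 <= z < 17) = false by lia.
  rewrite E0 /gval; last by lia.
  by rewrite ltnNge lez EU //; lia.
have Ex : extends gval rho.
  move=> z lez; rewrite /rho; have -> : (10 <= z < 17) = false by lia.
  by apply: E0; lia.
have [|rho1 [A S]] := sat_disjF_intro okd Ex (e := e); last first.
  exists rho1; split=> // z Hz; rewrite A /rho; last by lia.
  by have -> : (10 <= z < 17) = false by lia.
elim: d okd Hd => //= s d IH /andP[/andP[_ oks] okd] [Hs|/(IH okd)]; [left|by right].
elim: s oks Hs => //= a s IHs /andP[oka oks] [Ha /(IHs oks)]; split=> //.
case: a oka Ha => [x k y /and3P[ox ok oy]|x y /andP[ox oy]] /= Ha; rewrite !rhoE ?Ha //.
have [Sx Sk Sy] := holds_support Ha.
by apply: (gfact_elt gval_mark); rewrite /fact_rel !val_to_carrier.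
Qed.

Variable rhoT : nat -> value.
Hypothesis rhoT_cst : forall z, 50 <= z -> rhoT z = cst z.
Hypothesis rhoT_top : csat (holds L) rhoT (top_atoms n).

(** Every head or tail fact of a good set is a genuine [list_fact], so the list determines the value
    and the empty list has none. *)
Lemma sat_structF rho : extends gval rho -> sat e rho structF.
Proof.
move=> E; have kvE k : rho (kv k) = gval (kv k) by apply: E; have := kv_ge k; lia.
have Ssupp k : k = KHd \/ k = KTl -> cst (kv k) \in support.
  by move=> Hk; rewrite mem_cat; apply/orP; left; rewrite inE mem_cat; apply/orP; right;
  apply/orP; left; apply: mem_key_map; case: Hk => ->; [left | right; left].
case=> Hk /(sat_factF _ _ _ _ _ E) F.
have {F} /gfact_supported[a [b [d [E0 E1 E2 S]]]] : gfact e gval (rho 0) (rho 1) (rho 2).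
  by exists (rho 4), (rho 5), (rho 6).
have [k0 Hk0 {}Hk] : exists2 k, k = KHd \/ k = KTl & rho 1 = gval (kv k).
  by case: Hk => /= ->; rewrite kvE; [exists KHd; first left | exists KTl; first right].
have lf (v : carrier) : supported h L (val a) (val b) (val v) -> list_fact k0 (val a) (val v).
  case=> k [_ [Eb lf _ _ _]]; rewrite -(kv_support_inj (Ssupp _ Hk0) _ Eb) //.
  by rewrite -E1.
split.
  rewrite /= kvE gval_kv E0 => -[Ea]; have := lf _ S.
  rewrite Ea val_to_carrier cst_kv ?nil_support //.
  by case: Hk0 => -> [m [xs []]].
move=> /(sat_factF _ _ _ _ _ E) F.
have {F} /gfact_supported[a' [b' [d' [E0' E1' E3 S']]]] : gfact e gval (rho 0) (rho 1) (rho 3).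
  by exists (rho 7), (rho 8), (rho 9).
rewrite /= E2 E3; congr elt; apply: val_inj.
have [Ea] : elt a' = elt a by rewrite -E0.
have [Eb] : elt b' = elt b by rewrite -E1.
rewrite {}Ea {}Eb in S'; move: (lf _ S) (lf _ S').
case: Hk0 => -> [m [xs [-> ->]]] [m' [xs' [[]]]].
  by move=> -> _ ->.
by move=> _ -> ->.
Qed.

Lemma sat_close_model rho : sat e rho (close (matrixF (programF h) n)).
Proof.
refine (@sat_close_intro _ e _ gval rho (qfree_matrixF h n) _) => rho0 E0.
suff [rho1 [A S]] : exists rho1, agree_off 10 40 rho0 rho1 /\
    (sat e rho1 (topF n) /\ forall k, is_rule_key k -> sat e rho1 (ruleF k (rule h k))).
  have E := extends_agree E0 A.
  case: S => St Sr; exists rho1; split=> //; split; split=> //.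
  - exact: sat_structF.
  - by apply/sat_rulesF => k Hk; apply: Sr; left.
  - apply/sat_numeralsF => i lei; have := Sr (KNum i).
    by case: (i) lei => [|i'] lei; apply; right; [exists 0 | exists i'.+1].
have kvE rho1 k : agree_off 10 40 rho0 rho1 -> rho1 (kv k) = gval (kv k).
  by move=> A; apply: (extends_agree E0 A); have := kv_ge k; lia.
have fireP rho1 k : agree_off 10 40 rho0 rho1 -> 
    sat e rho1 (FAnd (FEq 1 (kv k)) (factF 0 1 2 4)) ->
    gfact e gval (rho0 0) (rho0 1) (rho0 2) /\ rho0 1 = gval (kv k).
  move=> A [E1 F]; split; last by move: E1; rewrite /= (kvE _ _ A) A.
  have E := extends_agree E0 A.
  move/(sat_factF _ _ _ _ _ E): F; rewrite !A // => F.
  by exists (rho0 4), (rho0 5), (rho0 6).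
(* If variables 0, 1, 2 form a fact, only the rule of its key can fire, and the support of the fact
   gives the witnesses. Otherwise no rule fires, and the witnesses serve [topF]. *)
case: (boolP [exists a, exists b, exists d,
    [&& rho0 0 == elt a, rho0 1 == elt b, rho0 2 == elt d & fact_rel a b d]]).
  case/existsP=> a /existsP[b /existsP[d /and4P[/eqP Ea /eqP Eb /eqP Ed /gL]]].
  case=> k [rhoU [Ek _ [U0 U2] EU Hd]].
  have inK (v : carrier) : to_carrier (val v) = v by apply: val_inj; rewrite val_to_carrier ?(valP v).
  have [|rho1 [A S]] := transfer EU E0 _ (okrule_rule h k) Hd.
    by move=> _; rewrite U0 U2 !inK.
  exists rho1; split=> //; split=> [|k' Hk'].
    have Stop : cst (kv KTop) \in support.
      rewrite mem_cat; apply/orP; left; rewrite inE mem_cat; apply/orP; right.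
      by apply/orP; left; apply: mem_key_map; right; right; left.
    (* The rule of [KTop] is the empty disjunction, so no supported fact has this key. *)
    move=> /= E1; have kT : k = KTop.
      by apply: (kv_support_inj Stop _ Ek); rewrite -Eb -(kvE rho1) // -E1 A.
    by rewrite kT in Hd.
  case/(fireP _ _ A) => _ E1; suff <- : k = k' by [].
  by apply: (kv_support_inj (rule_key_support Hk') _ Ek); rewrite -Eb.
move=> noF; have [//||rho1 [A S]] := transfer rhoT_cst E0 _ (okrule_top n).
  by left; apply: rhoT_top.
exists rho1; split=> //; split=> [_|k Hk]; first by case: S.
case/(fireP _ _ A) => /(elt_gfact gval_mark)[a [b [d [Ea Eb Ed Hf]]]] _.
case/negP: noF; apply/existsP; exists a; apply/existsP; exists b; apply/existsP; exists d.
by rewrite Ea Eb Ed !eqxx.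
Qed.

End FiniteModel.

Lemma close_true_on_finite_graph h n : reval h [:: n] 0 ->
  true_on_some_finite_graph (close (matrixF (programF h) n)).
Proof.
move=> ev.
pose rhoT z := if z == 10 then num n else if z == 11 then inl [:: n] else cst z.
have EC z : 50 <= z -> rhoT z = cst z.
  move=> lez; rewrite /rhoT; have -> : (z == 10) = false by lia.
  by have -> : (z == 11) = false by lia.
have ET k : rhoT (kv k) = if k is KNil then inl [::] else inr (kv k).
  by rewrite -cst_kv; apply: EC; have := kv_ge k; lia.
have [|L [gL HL]] := @good_of_csat h rhoT (top_atoms n).
  rewrite /= !ET /rhoT /=; do !split.
  - exact: derivable_KNum.
  - exact: derivable_hd.
  - exact: derivable_tl.
  - exact: derivable_goal (derivable_reval h ev).
exists (vertex (carrier h n L)), (mark _ 0), (adj (@fact_rel h n L)).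
split; [exact: adj_irr | split; [exact: adj_sym | move=> rho]].
exact (sat_close_model gL EC HL rho).
Qed.

Theorem theorem5p10 :
  exists l m n : nat,
    ~ decidable_set (fun f : form => in_class l m n f /\ true_on_some_finite_graph f).
Proof.
exists 10, 40, 0 => -[r Hr].
have [s Hs] := computable_close_matrixF.
(* Since [s] maps [n] to the code of [f], running [h] on [n] runs [r] on [f]; [h] itself is fixed
   before [n]. *)
pose h := RComp r [:: s]; pose n := encode (programF h).
pose f := close (matrixF (programF h) n).
have evh y : reval r [:: encode f] y -> reval h [:: n] y.
  by move=> ev; apply: ev_comp ev; constructor; [apply: Hs | constructor].
have [Hyes Hno] := Hr f.
(* Were [f] in the set, [h] would return 1 on [n], and then no graph could satisfy [f]. *)
have nP : ~ (in_class 10 40 0 f /\ true_on_some_finite_graph f).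
  move=> P; have ev := evh _ (Hyes P); case: P => _ [T [t0 [e [_ [_ S]]]]].
  exact: (not_sat_close (S (fun=> t0)) ev).
apply: (nP); split; first exact: close_in_class (qfree_matrixF h n).
exact: close_true_on_finite_graph (evh _ (Hno nP)).
Qed.
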